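(* Let $C$ be any real $m\times k$ matrix and $R$ any real $k\times n$ matrix, and let $A = CR$. Let $P$ be a real $m\times p$ matrix and $Q$ a real $n\times q$ matrix satisfying $$\mathrm{rank}(P^{\mathrm T}A) = \mathrm{rank}(AQ) = \mathrm{rank}(A).$$ Then the pseudoinverse of $A$ is given by $$A^+ = \left((P^{\mathrm T}CR)^+P^{\mathrm T}C\right)\left(RQ(CRQ)^+\right).$$
   Context: For a real $s\times t$ matrix $M$, $M^+$ denotes its Moore–Penrose pseudoinverse: the unique real $t\times s$ matrix satisfying the four Penrose identities $MM^+M=M$, $M^+MM^+=M^+$, $(M^+M)^{\mathrm T}=M^+M$, $(MM^+)^{\mathrm T}=MM^+$. No rank assumptions are made on $C$ and $R$ individually. *)

(* Defs.v *)
From mathcomp Require Import all_boot all_order all_algebra.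

Set Implicit Arguments.
Unset Strict Implicit.
Unset Printing Implicit Defensive.

Import Order.TTheory GRing.Theory Num.Theory.
Local Open Scope ring_scope.

Definition penrose (K : realFieldType) (s t : nat)
    (M : 'M[K]_(s, t)) (X : 'M[K]_(t, s)) : bool :=
  [&& M *m X *m M == M,
      X *m M *m X == X,
      (X *m M)^T == X *m M &
      (M *m X)^T == M *m X].

Lemma penrose_unique (K : realFieldType) (s t : nat)
    (M : 'M[K]_(s, t)) (X Y : 'M[K]_(t, s)) :
  penrose M X -> penrose M Y -> X = Y.
Proof.
case/and4P=> /eqP X1 /eqP X2 /eqP X3 /eqP X4.
case/and4P=> /eqP Y1 /eqP Y2 /eqP Y3 /eqP Y4.
have XM : X *m M = Y *m M.
  by rewrite -X3 -{1}Y1 -mulmxA mulmxA trmx_mul Y3 X3 -!mulmxA (mulmxA M X M) X1.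
have MX : M *m X = M *m Y.
  by rewrite -X4 -{1}Y1 -mulmxA trmx_mul X4 Y4 mulmxA X1.
by rewrite -X2 XM -mulmxA MX mulmxA Y2.
Qed.

Lemma gram_unitmx (K : realFieldType) (s t : nat) (B : 'M[K]_(s, t)) :
  row_free B -> B *m B^T \in unitmx.
Proof.
move=> freeB; rewrite -row_free_unit -kermx_eq0.
apply/rowV0P => v /sub_kermxP; rewrite mulmxA => vBB.
have vB : v *m B = 0.
  have: (v *m B) *m (v *m B)^T = 0 by rewrite trmx_mul mulmxA vBB mul0mx.
  move: (v *m B) => w /matrixP/(_ 0 0); rewrite mxE [RHS]mxE => w0.
  apply/rowP => j; rewrite mxE; apply/eqP; rewrite -sqrf_eq0 expr2.
  have w_ge0 i : true -> 0 <= w 0 i * w^T i 0.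
    by move=> _; rewrite [w^T _ _]mxE -expr2 sqr_ge0.
  by have := @psumr_eq0P _ _ xpredT _ w_ge0 w0 j isT; rewrite [w^T _ _]mxE => ->.
by apply: (row_free_inj freeB); rewrite vB mul0mx.
Qed.

Lemma penrose_exists (K : realFieldType) (s t : nat) (M : 'M[K]_(s, t)) :
  exists X, penrose M X.
Proof.
have [r [C [R [-> fullC freeR]]]] : exists r (C : 'M_(s, r)) (R : 'M_(r, t)),
    [/\ M = C *m R, row_full C & row_free R].
  exists (\rank M), (col_base M), (row_base M).
  by rewrite mulmx_base col_base_full row_base_free.
have uR : R *m R^T \in unitmx by apply: gram_unitmx.
have uC : C^T *m C \in unitmx.
  rewrite -{2}[C]trmxK; apply: gram_unitmx.
  by rewrite /row_free mxrank_tr.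
pose S := invmx (R *m R^T); pose T := invmx (C^T *m C).
have RS : R *m (R^T *m S) = 1%:M by rewrite mulmxA mulmxV.
have TC : T *m C^T *m C = 1%:M by rewrite -mulmxA mulVmx.
have symS : S^T = S by rewrite trmx_inv trmx_mul trmxK.
have symT : T^T = T by rewrite trmx_inv trmx_mul trmxK.
pose X := R^T *m S *m (T *m C^T); exists X.
have MX : C *m R *m X = C *m (T *m C^T).
  by rewrite /X -mulmxA (mulmxA R) RS mul1mx.
have XM : X *m (C *m R) = R^T *m S *m R.
  by rewrite /X -mulmxA (mulmxA (T *m C^T)) TC mul1mx.
apply/and4P; split; apply/eqP.
- by rewrite MX mulmxA -(mulmxA C) TC mulmx1.
- by rewrite XM /X mulmxA -(mulmxA (R^T *m S)) RS mulmx1.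
- by rewrite XM !trmx_mul trmxK symS mulmxA.
- by rewrite MX !trmx_mul trmxK symT mulmxA.
Qed.

(* Not mxalgebra's [pinvmx], which in general fails the two symmetry
   identities. The witness is unique by [penrose_unique]. *)
Definition mpinv (K : realFieldType) (s t : nat) (M : 'M[K]_(s, t)) :
    'M[K]_(t, s) :=
  xchoose (penrose_exists M).

Lemma mpinvP (K : realFieldType) (s t : nat) (M : 'M[K]_(s, t)) :
  penrose M (mpinv M).
Proof. exact: xchooseP. Qed.

(* Main.v *)
Require Import Defs.
From mathcomp Require Import all_boot all_order all_algebra.
From mathcomp Require Import reals.

(** Write [A^+] for [mpinv A].  The matrix [A^+ A] is the orthogonal projector
    onto the row space of [A], so it depends on that row space only
    ([mpinv_mulmx_eq]); dually [A A^+] depends only on the column space.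
    Multiplying [A] by [P^T] on the left can only shrink its row space, hence
    the rank hypothesis forces [P^T A] to have the same row space as [A];
    likewise [A Q] has the same column space as [A].  With [B = P^T A] and
    [D = A Q], this gives [B^+ B = A^+ A] and [D D^+ = A A^+].  The factors of
    the claimed formula regroup, through [A = C R], as [(B^+ B) Q D^+], and

      [(B^+ B) Q D^+ = A^+ (A Q) D^+ = A^+ (D D^+) = A^+ A A^+ = A^+]. *)

Set Implicit Arguments.
Unset Strict Implicit.
Unset Printing Implicit Defensive.

Import Order.TTheory GRing.Theory Num.Theory.
Local Open Scope ring_scope.

(** The four Penrose identities are exchanged in pairs by transposition. *)
Lemma mpinv_tr (K : realFieldType) (s t : nat) (M : 'M[K]_(s, t)) :
  mpinv M^T = (mpinv M)^T.
Proof.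
apply: (penrose_unique (mpinvP M^T)).
have /and4P[/eqP MXM /eqP XMX /eqP symXM /eqP symMX] := mpinvP M.
apply/and4P; split; apply/eqP.
- by rewrite -!trmx_mul mulmxA MXM.
- by rewrite -!trmx_mul mulmxA XMX.
- by rewrite -!trmx_mul symMX.
- by rewrite -!trmx_mul symXM.
Qed.

(** [B^+ B] fixes the rows of [B], hence everything that they span. *)
Lemma mulmx_mpinv_sub (K : realFieldType) (r s t : nat)
    (A : 'M[K]_(r, t)) (B : 'M[K]_(s, t)) :
  (A <= B)%MS -> A *m (mpinv B *m B) = A.
Proof.
case/submxP=> W ->; have /and4P[/eqP BXB _ _ _] := mpinvP B.
by rewrite -mulmxA (mulmxA B) BXB.
Qed.

(** Two projectors with the same range absorb each other on one side; since
    both are symmetric, transposing one absorption identity makes them equal. *)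
Lemma mpinv_mulmx_eq (K : realFieldType) (r s t : nat)
    (A : 'M[K]_(r, t)) (B : 'M[K]_(s, t)) :
  (A == B)%MS -> mpinv A *m A = mpinv B *m B.
Proof.
case/andP=> sAB sBA.
have /and4P[_ _ /eqP symA _] := mpinvP A.
have /and4P[_ _ /eqP symB _] := mpinvP B.
have EF : mpinv A *m A *m (mpinv B *m B) = mpinv A *m A.
  by rewrite -mulmxA (mulmx_mpinv_sub sAB).
have FE : mpinv B *m B *m (mpinv A *m A) = mpinv B *m B.
  by rewrite -mulmxA (mulmx_mpinv_sub sBA).
by rewrite -symA -EF trmx_mul symA symB FE.
Qed.

Lemma mpinv_mulmx_rank (K : realFieldType) (r s t : nat)
    (U : 'M[K]_(r, s)) (A : 'M[K]_(s, t)) :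
  \rank (U *m A) = \rank A -> mpinv (U *m A) *m (U *m A) = mpinv A *m A.
Proof.
move=> eq_rank; apply: mpinv_mulmx_eq.
by rewrite -(mxrank_leqif_eq (submxMl U A)) eq_rank.
Qed.

Lemma mulmx_mpinv_rank (K : realFieldType) (r s t : nat)
    (A : 'M[K]_(r, s)) (V : 'M[K]_(s, t)) :
  \rank (A *m V) = \rank A -> A *m V *m mpinv (A *m V) = A *m mpinv A.
Proof.
move=> eq_rank; apply: trmx_inj; rewrite !trmx_mul -!mpinv_tr trmx_mul.
by apply: mpinv_mulmx_rank; rewrite -trmx_mul !mxrank_tr.
Qed.

Theorem theorem3 (K : realType) (m k n p q : nat)
    (C : 'M[K]_(m, k)) (R : 'M[K]_(k, n)) (A : 'M[K]_(m, n))
    (P : 'M[K]_(m, p)) (Q : 'M[K]_(n, q))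
    (hA : A = C *m R)
    (hP : \rank (P^T *m A) = \rank A)
    (hQ : \rank (A *m Q) = \rank A) :
  mpinv A = (mpinv (P^T *m C *m R) *m P^T *m C)
              *m (R *m Q *m mpinv (C *m R *m Q)).
Proof.
have /and4P[_ /eqP XAX _ _] := mpinvP A.
have regroup (X : 'M[K]_(n, p)) (Y : 'M[K]_(q, m)) :
    X *m P^T *m C *m (R *m Q *m Y) = X *m (P^T *m A) *m Q *m Y.
  by rewrite hA !mulmxA.
rewrite -[P^T *m C *m R]mulmxA -hA regroup (mpinv_mulmx_rank hP).
by rewrite -!mulmxA (mulmxA A) (mulmx_mpinv_rank hQ) mulmxA XAX.
Qed.
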